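(* Fix a subset $P$ of the simple roots $\Delta$, with corresponding parabolic subgroup (also denoted $P$) containing $B$ and corresponding subgroup $W_P$ of $W$. Let $m_P=|W_P|$. Let $\chi_P$ denote the character of the restriction to $W_P$ of Kostant–Kumar's action of $W$ on $H^*_T(G/B)$. Then $$\chi_P=m_P\,\chi,$$ where $\chi$ is the character of Kostant–Kumar's action of $W_P$ on $H^*_T(P/B)$.
   Context: $G$ is a complex reductive linear algebraic group, $B$ a fixed Borel subgroup, $T\subseteq B$ the maximal torus, $W$ the Weyl group with simple reflections $s_1,\dots,s_n$ corresponding to the simple roots $\Delta=\{\alpha_1,\dots,\alpha_n\}$, and $\ell$ the length function. $W_P$ is the subgroup generated by the simple reflections in the chosen subset of simple roots (it is the Weyl group of $P/B$). $T$ acts by left multiplication; cohomology has coefficients in $\mathbb{C}$, and $\mathbb{C}[\mathfrak{t}^*]=H^*_T(pt)$ is the polynomial ring (symmetric algebra) on $\mathfrak{t}^*$, containing the roots as degree-one elements. The $T$-fixed points of $G/B$ are identified with $W$. Restriction to fixed points is injective, so $H^*_T(G/B)$ is regarded as a $\mathbb{C}[\mathfrak{t}^*]$-subalgebra of the ring of functions $W\to\mathbb{C}[\mathfrak{t}^*]$ with pointwise operations. It is a free $\mathbb{C}[\mathfrak{t}^*]$-module with basis the equivariant Schubert classes $\{\sigma_w : w\in W\}$, given by Billey's formula: for $u\in W$ with any fixed reduced word $u=s_{b_1}\cdots s_{b_{\ell(u)}}$, set $\mathbf{r}(\mathbf{i},u)=s_{b_1}\cdots s_{b_{i-1}}(\alpha_{b_i})$;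 then $$\sigma_v(u)=\sum \prod_{i=1}^{\ell(v)}\mathbf{r}(\mathbf{j_i},u),$$ where the sum is over all $1\le j_1<\dots<j_{\ell(v)}\le \ell(u)$ such that $s_{b_{j_1}}\cdots s_{b_{j_{\ell(v)}}}$ is a reduced word for $v$. Likewise the $T$-fixed points of $P/B$ are identified with $W_P$, and $H^*_T(P/B)$ is the $\mathbb{C}[\mathfrak{t}^*]$-subalgebra of functions $W_P\to\mathbb{C}[\mathfrak{t}^*]$ that is free over $\mathbb{C}[\mathfrak{t}^*]$ with basis the Schubert classes indexed by $w\in W_P$, given by the same formula for $\sigma_w(u)$ with $u\in W_P$. Kostant–Kumar's action of $W$ on $H^*_T(G/B)$ (the Springer representation): for $w\in W$ and $p\in H^*_T(G/B)$, the class $w\cdot p$ is given by $(w\cdot p)(v)=p(vw^{-1})$ for all $v\in W$; each $p\mapsto w\cdot p$ is a $\mathbb{C}[\mathfrak{t}^*]$-algebra homomorphism of $H^*_T(G/B)$. The action of $W_P$ on $H^*_T(P/B)$ is given by the same rule with $w,v\in W_P$. The character is the function sending a group element to the trace of the corresponding $\mathbb{C}[\mathfrak{t}^*]$-linear endomorphism of the free $\mathbb{C}[\mathfrak{t}^*]$-module in question.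
   Formalization: The constant m_P is taken to be the index [W : W_P] instead of |W_P|: at the identity the characters equal |W| and |W_P|, so the literal claim would force |W| = |W_P|^2, which fails for example for P empty and W nontrivial. *)

(* Defs.v *)
From HB Require Import structures.
From mathcomp Require Import all_boot all_order all_algebra all_fingroup.
From mathcomp Require Import complex mpoly.
From mathcomp Require Import boolp classical_sets reals.

Set Implicit Arguments.
Unset Strict Implicit.
Unset Printing Implicit Defensive.

Import GRing.Theory.
Local Open Scope ring_scope.

(* A connected complex reductive group G together with B and T is given by its
   based root datum: the character lattice of T is identified with 'rV[int]_r,
   the cocharacter lattice with its dual, and 'I_n indexes the simple roots. *)

Definition pairing (r : nat) (x y : 'rV[int]_r) : int := \sum_k x 0 k * y 0 k.

Record based_root_datum (r n : nat) := BasedRootDatum {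
  root_idx : finType;
  rootv : root_idx -> 'rV[int]_r;
  corootv : root_idx -> 'rV[int]_r;
  root_inj : injective rootv;
  coroot_inj : injective corootv;
  pairing_root_coroot : forall a, pairing (rootv a) (corootv a) = 2;
  root_stable : forall a b, exists c,
    rootv c = rootv b - pairing (rootv b) (corootv a) *: rootv a;
  coroot_stable : forall a b, exists c,
    corootv c = corootv b - pairing (rootv a) (corootv b) *: corootv a;
  root_reduced : forall a b (k l : int),
    k != 0 -> k *: rootv a = l *: rootv b -> rootv a = rootv b \/ rootv a = - rootv b;
  simple_root : 'I_n -> root_idx;
  simple_free : forall c : 'I_n -> int,
    \sum_i c i *: rootv (simple_root i) = 0 -> forall i, c i = 0;
  simple_span : forall a, exists c : 'I_n -> nat,
    rootv a = \sum_i (c i)%:Z *: rootv (simple_root i) \/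
    rootv a = - \sum_i (c i)%:Z *: rootv (simple_root i)
}.

Section Weyl.
Variables (r n : nat) (D : based_root_datum r n).

Lemma refl_ex (a b : root_idx D) :
  exists c : root_idx D, rootv c == rootv b - pairing (rootv b) (corootv a) *: rootv a.
Proof. by have [c cE] := root_stable a b; exists c; apply/eqP. Qed.

Definition refl_fun (a b : root_idx D) : root_idx D := xchoose (refl_ex a b).

Lemma refl_funE a b :
  rootv (refl_fun a b) = rootv b - pairing (rootv b) (corootv a) *: rootv a.
Proof. exact: eqP (xchooseP (refl_ex a b)). Qed.

Lemma pairingBZ (x y z : 'rV[int]_r) k :
  pairing (x - k *: y) z = pairing x z - k * pairing y z.
Proof.
rewrite /pairing mulr_sumr -sumrB; apply: eq_bigr => i _.
by rewrite !mxE mulrBl mulrA.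
Qed.

Lemma refl_funK a : involutive (refl_fun a).
Proof.
move=> b; apply: (@root_inj _ _ D).
rewrite !refl_funE pairingBZ pairing_root_coroot.
set m := pairing _ _; rewrite -addrA -opprD -scalerDl.
by rewrite mulr_natr mulr2n addrA subrr scale0r subr0.
Qed.

Definition refl (a : root_idx D) : {perm root_idx D} := perm (inv_inj (refl_funK a)).

(* Permutations multiply left to right in MathComp, whereas words in W are
   compositions of maps. An element w of W is therefore represented so that it
   acts on the roots by the permutation w^-1 (see wact below); the reflections,
   being involutions, are unaffected. The action of W on the roots is faithful,
   as W fixes a complement of their span in the rational character space. *)
Definition weyl_group : {group {perm root_idx D}} :=
  <<[set refl (simple_root D i) | i : 'I_n]>>%G.

Definition weyl : finGroupType := [subg weyl_group].

Definition srefl (i : 'I_n) : weyl := subg weyl_group (refl (simple_root D i)).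

Definition wact (w : weyl) (a : root_idx D) : root_idx D := ((sgval w)^-1)%g a.

Definition word_prod (b : seq 'I_n) : weyl := (\prod_(i <- b) srefl i)%g.

Definition is_reduced (b : seq 'I_n) : bool :=
  [forall k : 'I_(size b), forall c : k.-tuple 'I_n, word_prod c != word_prod b].

Definition reduced_word (w : weyl) (b : seq 'I_n) : bool :=
  (word_prod b == w) && is_reduced b.

Lemma sgval_srefl i : sgval (srefl i) = refl (simple_root D i).
Proof. by rewrite subgK //; apply: mem_gen; apply: imset_f. Qed.

Lemma word_ex (w : weyl) : exists b, word_prod b = w.
Proof.
have /gen_prodgP[k [c cP wE]] := subgP w.
have pick_ex i : exists j, c i == refl (simple_root D j).
  by have /imsetP[j _ ->] := cP i; exists j.
exists [seq xchoose (pick_ex i) | i <- index_enum _].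
apply: subg_inj; rewrite wE /word_prod big_map.
rewrite (@big_morph _ _ sgval 1%g (fun x y => (x * y)%g) 1%g (fun x y => (x * y)%g)) //.
by apply: eq_bigr => i _; rewrite sgval_srefl -(eqP (xchooseP (pick_ex i))).
Qed.

Lemma reduced_word_ex (w : weyl) : exists b, reduced_word w b.
Proof.
have ex : exists k, [exists b : k.-tuple 'I_n, word_prod b == w].
  by have [b <-] := word_ex w; exists (size b); apply/existsP; exists (in_tuple b).
case: (ex_minnP ex) => k /existsP[b /eqP bw] kmin; exists b.
rewrite /reduced_word bw eqxx; apply/forallP => l; apply/forallP => c.
apply/negP => /eqP cw; have := ltn_ord l; rewrite {2}size_tuple ltnNge.
by rewrite kmin //; apply/existsP; exists c; rewrite cw bw.
Qed.

Definition redword (w : weyl) : seq 'I_n := xchoose (reduced_word_ex w).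

Lemma redwordP w : reduced_word w (redword w).
Proof. exact: xchooseP. Qed.

Definition parabolic (P : {set 'I_n}) : {group weyl} := <<[set srefl i | i in P]>>%G.

End Weyl.

Section Schubert.
Variables (R : realType) (r n : nat) (D : based_root_datum r n).

(* The symmetric algebra on the dual of Lie(T): the variables are the chosen
   basis of the character lattice, which is also a basis of that dual space. *)
Definition Ct : idomainType := {mpoly R[i][r]}.

Definition root_poly (a : root_idx D) : Ct := \sum_(k < r) 'X_k *~ rootv a 0 k.

Definition rfactor (b : seq 'I_n) (j : 'I_(size b)) : Ct :=
  root_poly (wact (word_prod D (take j b)) (simple_root D (tnth (in_tuple b) j))).

(* enum J lists the positions j_1 < ... < j_k in increasing order. *)
Definition subword (b : seq 'I_n) (J : {set 'I_(size b)}) : seq 'I_n :=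
  [seq tnth (in_tuple b) j | j <- enum J].

Definition billey (v : weyl D) (b : seq 'I_n) : Ct :=
  \sum_(J : {set 'I_(size b)} | reduced_word v (subword J)) \prod_(j in J) rfactor j.

Definition schubert (v : weyl D) : {ffun weyl D -> Ct^o} :=
  [ffun u => billey v (redword u)].

Definition schubertP (P : {set 'I_n}) (v : [subg parabolic D P]) :
    {ffun [subg parabolic D P] -> Ct^o} :=
  [ffun u => billey (sgval v) (redword (sgval u))].

End Schubert.

Section FreeTrace.
Variables (S : comNzRingType) (V : lmodType S).

Definition lspan (I : finType) (e : I -> V) : set V :=
  [set x | exists c : I -> S, x = \sum_i c i *: e i].

Definition is_basis (H : set V) (k : nat) (e : 'I_k -> V) : Prop :=
  lspan e = H /\ forall c : 'I_k -> S, \sum_i c i *: e i = 0 -> forall i, c i = 0.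

Definition is_trace (H : set V) (f : V -> V) (t : S) : Prop :=
  exists k (e : 'I_k -> V) (M : 'M[S]_k),
    [/\ is_basis H e, forall j, f (e j) = \sum_i M i j *: e i & t = \tr M].

(* The trace of an endomorphism of the free module H, read off in any finite
   basis of H; the default value 0 is only used when f has no matrix in such a
   basis, which does not occur for the modules and actions below. *)
Definition free_trace (H : set V) (f : V -> V) : S := xget 0 (is_trace H f).

End FreeTrace.

Section Characters.
Variables (R : realType) (r n : nat) (D : based_root_datum r n).

Definition HT_GB : set {ffun weyl D -> (Ct R r)^o} := lspan (schubert R (D := D)).

Definition HT_PB (P : {set 'I_n}) : set {ffun [subg parabolic D P] -> (Ct R r)^o} :=
  lspan (schubertP R (D := D) (P := P)).

Definition KK_act (gT : finGroupType) (w : gT) (p : {ffun gT -> (Ct R r)^o}) :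
    {ffun gT -> (Ct R r)^o} :=
  [ffun v => p (v * w^-1)%g].

Definition chi_GB (w : weyl D) : Ct R r := free_trace HT_GB (KK_act w).

Definition chi_res (P : {set 'I_n}) (w : [subg parabolic D P]) : Ct R r :=
  chi_GB (sgval w).

Definition chi_PB (P : {set 'I_n}) (w : [subg parabolic D P]) : Ct R r :=
  free_trace (@HT_PB P) (KK_act w).

End Characters.

(* Main.v *)
(* The matrix of values of the Schubert classes is triangular: sigma_v(u) vanishes
   unless v is the product of a reduced subword of a reduced word of u, and
   sigma_v(v) is a product of roots, hence nonzero. So the Schubert classes span
   all functions on the group over the fraction field, and the trace of right
   translation is the number of its fixed points: the group order at 1, and 0
   elsewhere. Both characters are thus multiples of the indicator function of 1,
   and their ratio is the index of W_P in W. *)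

Require Import Defs.
From HB Require Import structures.
From mathcomp Require Import all_boot all_order all_algebra all_fingroup.
From mathcomp Require Import complex mpoly.
From mathcomp Require Import boolp classical_sets reals.

Set Implicit Arguments.
Unset Strict Implicit.
Unset Printing Implicit Defensive.

Import GRing.Theory.
Local Open Scope ring_scope.

Lemma sum_enum_val (T : finType) (V : nmodType) (F : T -> V) :
  \sum_v F v = \sum_(j < #|T|) F (enum_val j).
Proof. by rewrite (reindex (@enum_val T T)) //; exact/onW_bij/enum_val_bij. Qed.

Lemma lspan_mem (S : comNzRingType) (V : lmodType S) (I : finType) (e : I -> V) i :
  lspan e (e i).
Proof.
exists (fun j => (j == i)%:R); rewrite (bigD1 i) //= eqxx scale1r big1 ?addr0 //.
by move=> j /negPf ->; rewrite scale0r.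
Qed.

Section PullbackTrace.
Variables (S : idomainType) (T : finType) (s : T -> {ffun T -> S^o}).
Hypothesis s_free : forall c : T -> S, \sum_v c v *: s v = 0 -> forall v, c v = 0.

Let N := #|T|.
Let values : 'M[S]_N := \matrix_(i, j) s (enum_val i) (enum_val j).

(** Over a domain a zero determinant yields a nonzero row vector killed by [values]. Read pointwise,
    this is a linear relation among the [s v]. *)
Lemma det_values_neq0 : \det values != 0.
Proof.
apply/negP => /det0P[c /negP cN0 c0]; apply: cN0; apply/eqP/rowP => i; rewrite mxE.
have := @s_free (fun v => c 0 (enum_rank v)) _ (enum_val i); rewrite enum_valK; apply.
apply/ffunP => u; rewrite sum_ffunE ffunE.
have /rowP/(_ (enum_rank u)) := c0; rewrite !mxE => c0u.
rewrite (@sum_enum_val T) -[RHS]c0u; apply: eq_bigr => j _.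
by rewrite ffunE mxE enum_valK enum_rankK.
Qed.

(** The values [E] of any basis [e] intertwine [M^T] with the 0/1 matrix [Q] of pullback along
    [phi], whose diagonal marks the fixed points. As [E] is invertible over the fraction field, the
    traces agree, whatever the basis and its size [k]. *)
Lemma is_trace_pullback (phi : T -> T) (f : {ffun T -> S^o} -> {ffun T -> S^o}) t :
    (forall p x, f p x = p (phi x)) -> is_trace (lspan s) f t ->
  t = #|[set x | phi x == x]|%:R.
Proof.
move=> fE [k [e [M [[eH e_free] feE ->]]]].
have /choice[a aE] : forall v, exists c : 'I_k -> S, s v = \sum_i c i *: e i.
  by move=> v; have := lspan_mem s v; rewrite -eH.
have /choice[b bE] : forall i, exists c : T -> S, e i = \sum_v c v *: s v.
  by move=> i; have := lspan_mem e i; rewrite eH.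
pose A : 'M[S]_(N, k) := \matrix_(i, j) a (enum_val i) j.
pose B : 'M[S]_(k, N) := \matrix_(i, j) b i (enum_val j).
pose E : 'M[S]_(k, N) := \matrix_(i, j) e i (enum_val j).
pose Q : 'M[S]_N := \matrix_(i, j) (enum_val i == phi (enum_val j))%:R.
have EB : E = B *m values.
  apply/matrixP => i j; rewrite !mxE bE sum_ffunE (@sum_enum_val T).
  by apply: eq_bigr => l _; rewrite ffunE !mxE.
have AE : A *m E = values.
  apply/matrixP => i j; rewrite !mxE aE sum_ffunE.
  by apply: eq_bigr => l _; rewrite ffunE !mxE.
(* Expanding [e i] in the [s v] and these back in the [e j] must return [e i]; freeness of [e]
   compares coefficients. *)
have BA : B *m A = 1%:M.
  apply/matrixP => i j; rewrite !mxE.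
  apply/eqP; rewrite -subr_eq0; apply/eqP.
  apply: (e_free (fun j => \sum_l B i l * A l j - (i == j)%:R)).
  under eq_bigr => l _ do rewrite scalerBl.
  rewrite sumrB; apply/eqP; rewrite subr_eq0; apply/eqP.
  rewrite [RHS](bigD1 i) //= eqxx scale1r [X in _ = _ + X]big1 ?addr0; last first.
    by move=> l; rewrite eq_sym => /negPf ->; rewrite scale0r.
  under eq_bigr => l _ do rewrite scaler_suml.
  rewrite exchange_big /= [RHS]bE (@sum_enum_val T).
  apply: eq_bigr => l _; rewrite aE scaler_sumr.
  by apply: eq_bigr => m _; rewrite !mxE scalerA.
have EQ : E *m Q = M^T *m E.
  apply/matrixP => i j; rewrite !mxE.
  transitivity (e i (phi (enum_val j))).
    rewrite (bigD1 (enum_rank (phi (enum_val j)))) //= !mxE enum_rankK eqxx mulr1.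
    rewrite big1 ?addr0 // => l /negPf lN.
    by rewrite !mxE -(inj_eq enum_rank_inj) enum_valK lN mulr0.
  by rewrite -fE feE sum_ffunE; apply: eq_bigr => l _; rewrite ffunE !mxE.
have trQ : \tr Q = #|[set x | phi x == x]|%:R.
  rewrite /mxtrace -sum1_card natr_sum [RHS]big_mkcond /= (@sum_enum_val T).
  by apply: eq_bigr => i _; rewrite mxE inE eq_sym; case: ifP.
(* Multiplying both traces by the nonzero determinant avoids leaving the ring [S]. *)
rewrite -trQ -mxtrace_tr; apply: (mulfI det_values_neq0).
(* X plays the role of det(values) times the inverse of E. *)
pose X := \adj values *m A.
have EX : E *m X = (\det values)%:M.
  by rewrite /X EB mulmxA -(mulmxA B) mul_mx_adj mul_mx_scalar -scalemxAl BA scalemx1.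
have XE : X *m E = (\det values)%:M by rewrite /X -mulmxA AE mul_adj_mx.
rewrite -2!mxtraceZ -[in LHS]mul_mx_scalar -EX mulmxA -EQ -mulmxA mxtrace_mulC.
by rewrite -mulmxA XE mul_mx_scalar.
Qed.

End PullbackTrace.

(** Supplies an actual trace for the identity, so that [free_trace] does not fall back on its
    default value there. *)
Lemma is_trace_id (S : comNzRingType) (T : finType) (V : lmodType S) (s : T -> V)
    (f : V -> V) :
    (forall c : T -> S, \sum_v c v *: s v = 0 -> forall v, c v = 0) ->
    f =1 id -> is_trace (lspan s) f #|T|%:R.
Proof.
move=> s_free fE; exists #|T|, (fun i => s (enum_val i)), 1%:M.
split; last by rewrite mxtrace1.
- split.
    apply/seteqP; split => x /= [c ->].
      exists (fun v => c (enum_rank v)); rewrite (@sum_enum_val T).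
      by under [RHS]eq_bigr do rewrite enum_valK.
    by exists (fun i => c (enum_val i)); rewrite (@sum_enum_val T).
  move=> c c0 i; rewrite -(enum_valK i).
  apply: (s_free (fun v => c (enum_rank v))); rewrite (@sum_enum_val T) -[RHS]c0.
  by under eq_bigr do rewrite enum_valK.
- move=> j; rewrite fE (bigD1 j) //= mxE eqxx scale1r big1 ?addr0 // => i /negPf iN.
  by rewrite mxE iN scale0r.
Qed.

Section Schubert.
Variables (R : realType) (r n : nat) (D : based_root_datum r n).

(** A root pairs to 2 with its coroot, so some integer coordinate is nonzero, and it stays nonzero
    in characteristic 0. *)
Lemma root_poly_neq0 (a : root_idx D) : root_poly R a != 0.
Proof.
apply/negP => /eqP a0; have := pairing_root_coroot a.
suff -> : rootv a = 0.
  by rewrite /pairing big1 // => i _; rewrite mxE mul0r.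
apply/rowP => k; rewrite mxE.
have /(congr1 (fun p => p@_U_(k)%MM)) := a0.
rewrite /root_poly mcoeff0 raddf_sum /= (bigD1 k) //= big1 ?addr0; last first.
  by move=> i /negPf iN; rewrite raddfMz /= mcoeffXU iN mul0rz.
rewrite raddfMz /= mcoeffXU eqxx => /eqP; rewrite intr_eq0.
by move/eqP.
Qed.

Lemma reduced_word_size (v : weyl D) b c :
  reduced_word v b -> word_prod D c = v -> (size b <= size c)%N.
Proof.
case/andP => /eqP bv /forallP bred cv; rewrite leqNgt; apply/negP => lt_cb.
have /forallP/(_ (in_tuple c)) := bred (Ordinal lt_cb).
by rewrite bv /= cv eqxx.
Qed.

Lemma size_subword (b : seq 'I_n) (J : {set 'I_(size b)}) : size (subword J) = #|J|.
Proof. by rewrite size_map -cardE. Qed.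

Lemma subword_setT (b : seq 'I_n) : subword [set: 'I_(size b)] = b.
Proof.
rewrite /subword enum_setT -enumT.
by rewrite -[RHS](map_tnth_enum (in_tuple b)).
Qed.

Lemma subword_full (b : seq 'I_n) (J : {set 'I_(size b)}) :
  (size b <= size (subword J))%N -> J = [set: 'I_(size b)].
Proof.
rewrite size_subword => leJ; apply/eqP.
by rewrite eqEcard finset.subsetT cardsT card_ord.
Qed.

Lemma billey_diag (v : weyl D) : billey R v (redword v) != 0.
Proof.
have vred := redwordP v.
rewrite /billey (bigD1 [set: _]) /=; last by rewrite subword_setT.
rewrite [X in _ + X]big1 ?addr0; first by apply/prodf_neq0 => j _; exact: root_poly_neq0.
move=> J /andP[/andP[/eqP Jv _]] /eqP[]; apply: subword_full.
exact: reduced_word_size vred Jv.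
Qed.

(** A nonzero sum has a subword with product [v]. If [v] is not shorter than [u], that subword is
    the whole word, so [v = u]. *)
Lemma billey_triangular (v u : weyl D) :
  billey R v (redword u) != 0 -> v != u ->
  (size (redword v) < size (redword u))%N.
Proof.
move=> nz; apply: contraNT; rewrite -leqNgt => le_uv.
case: (pickP (fun J : {set 'I_(size (redword u))} => reduced_word v (subword J))).
  move=> J /andP[/eqP Jv _].
  have /subword_full JT : (size (redword u) <= size (subword J))%N.
    exact: leq_trans le_uv (reduced_word_size (redwordP v) Jv).
  by rewrite -Jv JT subword_setT; case/andP: (redwordP u).
by move=> none; rewrite /billey big_pred0 ?eqxx in nz.
Qed.

(** Induction on the length of [g v]: evaluating the relation at [v] leaves, besides the nonzero
    diagonal term, only classes of shorter elements, whose coefficients already vanish. The map [g]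
    allows for both [W] and [W_P]. *)
Lemma schubert_free (I : finType) (g : I -> weyl D)
    (s := fun v => [ffun u => billey R (g v) (redword (g u))] : {ffun I -> (Ct R r)^o}) :
  injective g -> forall c : I -> Ct R r, \sum_v c v *: s v = 0 -> forall v, c v = 0.
Proof.
move=> g_inj c c0 v; have [m] := ubnP (size (redword (g v))).
elim: m v => // m IHm v; rewrite ltnS => le_v_m.
have /ffunP/(_ v) := c0; rewrite sum_ffunE (bigD1 v) //= big1 => [|u uNv].
  by rewrite addr0 !ffunE => /eqP; rewrite mulf_eq0 (negPf (billey_diag _)) orbF => /eqP.
rewrite !ffunE; have [->|nz] := eqVneq (billey R (g u) (redword (g v))) 0.
  exact: scaler0.
rewrite IHm ?scale0r //; apply: leq_trans le_v_m; apply: billey_triangular => //.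
by rewrite (inj_eq g_inj).
Qed.

Lemma KK_trace (gT : finGroupType) (g : gT -> weyl D)
    (s := fun v => [ffun u => billey R (g v) (redword (g u))] : {ffun gT -> (Ct R r)^o})
    (w : gT) :
  injective g ->
  free_trace (lspan s) (@KK_act R r gT w) = if w == 1%g then #|gT|%:R else 0.
Proof.
move=> g_inj; have s_free := schubert_free g_inj.
have trE t : is_trace (lspan s) (KK_act w) t -> t = if w == 1%g then #|gT|%:R else 0.
  move=> /(is_trace_pullback s_free (phi := fun v => (v * w^-1)%g)) ->.
    (* Right translation by a nontrivial element has no fixed point. *)
    have fixE v : (v * w^-1 == v)%g = (w == 1%g).
      by rewrite -[eqbRHS]mulg1 (inj_eq (mulgI v)) invg_eq1.
    under eq_finset do rewrite fixE.
    by case: eqP => _; rewrite ?cardsT // cards0.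
  by move=> p x; rewrite ffunE.
rewrite /free_trace; case: xgetP => [t _ /trE //|none].
(* Were there no trace, the default 0 would still be correct for [w] other than 1; existence matters
   only at 1. *)
case: eqP => // w1; case: (none #|gT|%:R).
apply: is_trace_id => // p; apply/ffunP => v.
by rewrite ffunE w1 invg1 mulg1.
Qed.

End Schubert.

Theorem theorem4p7 (R : realType) (r n : nat) (D : based_root_datum r n)
    (P : {set 'I_n}) (w : [subg parabolic D P]) :
  chi_res R w = (chi_PB R w *+ #|[set: weyl D] : parabolic D P|%g)%R.
Proof.
rewrite /chi_res /chi_GB /chi_PB (@KK_trace R r n D _ id) //.
rewrite (@KK_trace R r n D _ sgval); last exact: subg_inj.
have -> : (sgval w == 1%g) = (w == 1%g) by exact: (inj_eq subg_inj w 1%g).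
case: eqP => _; last by rewrite mul0rn.
(* At 1 the characters are the orders of [W] and [W_P]. By Lagrange the factor is the index of [W_P]
   in [W], which in general differs from the order of [W_P]. *)
rewrite -mulrnA -(cardsT (weyl D)) -(Lagrange (finset.subsetT (parabolic D P))).
by rewrite -cardsT (card_isog (isog_subg (parabolic D P))).
Qed.
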